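(* Let $N\in\mathbb{N}$, let $\mathcal{E}$ be a Hilbert space, and let $$K(z,z')=\sum_{w,w'\in\mathcal{F}_N}K_{w,w'}z^w z'^{\,w'^{\top}}\in\mathcal{L}(\mathcal{E})\langle\langle z,z'\rangle\rangle$$ be a formal power series in $2N$ non-commuting indeterminates $z=(z_1,\ldots,z_N)$, $z'=(z'_1,\ldots,z'_N)$. Then $K(z,z')$ is a positive non-commutative kernel if and only if for every $n\in\mathbb{N}$ the function $$K(Z,Z')=\sum_{w,w'\in\mathcal{F}_N}K_{w,w'}\otimes Z^w (Z'^* )^{w'^{\top}}\in\mathcal{L}(\mathcal{E}\otimes\mathbb{C}^n),\qquad Z,Z'\in\mathrm{Nilp}_N(n)$$ (a finite sum), is a positive $\mathcal{L}(\mathcal{E}\otimes\mathbb{C}^n)$-valued kernel on $\mathrm{Nilp}_N(n)$, i.e., for any integer $l$, any $Z^{(1)},\ldots,Z^{(l)}\in\mathrm{Nilp}_N(n)$ and any $x^{(1)},\ldots,x^{(l)}\in\mathcal{E}\otimes\mathbb{C}^n$, $$\sum_{j,k=1}^l\left\langle K(Z^{(j)},Z^{(k)})x^{(k)},x^{(j)}\right\rangle_{\mathcal{E}\otimes\mathbb{C}^n}\geq 0.$$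
   Context: Hilbert spaces are complex; $\mathcal{L}(\mathcal{E})$ is the algebra of bounded linear operators on $\mathcal{E}$. $\mathcal{F}_N$ is the free semigroup with unit $\emptyset$ (the empty word) on generators $g_1,\ldots,g_N$, with concatenation as multiplication. For $w=g_{j_1}\cdots g_{j_m}\in\mathcal{F}_N$, the transpose is $w^{\top}=g_{j_m}\cdots g_{j_1}$ and the length is $|w|=m$; $\emptyset^{\top}=\emptyset$, $|\emptyset|=0$. Put $z^w=z_{j_1}\cdots z_{j_m}$, $z^{\emptyset}=1$. $\mathcal{L}\langle\langle z_1,\ldots,z_d\rangle\rangle$ is the space of all formal power series in non-commuting indeterminates with coefficients in the vector space $\mathcal{L}$. Positive non-commutative kernel: a series $K(z,z')=\sum_{w,w'\in\mathcal{F}_N}K_{w,w'}z^wz'^{\,w'^{\top}}$ with $K_{w,w'}\in\mathcal{L}(\mathcal{E})$ is a positive non-commutative kernel if for any integer $l$, any words $w^{(1)},\ldots,w^{(l)}\in\mathcal{F}_N$ and any vectors $h^{(1)},\ldots,h^{(l)}\in\mathcal{E}$ one has $\sum_{j,k=1}^l\langle K_{w^{(j)},w^{(k)}}h^{(k)},h^{(j)}\rangle_{\mathcal{E}}\geq 0$. For an $N$-tuple $Z=(Z_1,\ldots,Z_N)\in(\mathbb{C}^{n\times n})^N$ and $w=g_{j_1}\cdots g_{j_m}$, put $Z^w=Z_{j_1}\cdots Z_{j_m}$, $Z^{\emptyset}=I_n$, and $Z^*=(Z_1^*,\ldots,Z_N^* )$. $\mathrm{Nilp}_N(n,r)$ is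 the set of $N$-tuples $Z\in(\mathbb{C}^{n\times n})^N$ such that $Z^w=0$ for all $w\in\mathcal{F}_N$ with $|w|\geq r$ (jointly nilpotent of rank at most $r$), and $\mathrm{Nilp}_N(n)=\bigcup_{r=1}^\infty\mathrm{Nilp}_N(n,r)$. *)

(* Defs.v *)
From HB Require Import structures.
From mathcomp Require Import all_boot all_order all_algebra.
From mathcomp Require Import sesquilinear spectral complex.
From mathcomp Require Import all_classical all_reals all_analysis.

Set Implicit Arguments.
Unset Strict Implicit.
Unset Printing Implicit Defensive.

Import Order.TTheory GRing.Theory Num.Theory.
Import numFieldNormedType.Exports.

Local Open Scope classical_set_scope.
Local Open Scope ring_scope.
Local Open Scope complex_scope.
Local Open Scope sesquilinear_scope.

(** Complex Hilbert spaces: the inner product is linear in its first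
    argument and conjugate-linear in its second. *)

HB.mixin Record CompleteNormedModule_isHilbert (R : realType) E
    & CompleteNormedModule R[i] E := {
  dotp : {dot E for @Num.conj R[i]} ;
  dotp_norm : forall x : E, dotp x x = `|x| ^+ 2
}.

#[short(type="hilbertType")]
HB.structure Definition Hilbert (R : realType) :=
  {E of CompleteNormedModule R[i] E & CompleteNormedModule_isHilbert R E}.

Section DotNorm.
Context (C : numClosedFieldType) (U : lmodType C) (f : {dot U for @Num.conj C}).

Lemma dot_CauchySchwarz u v : `|f u v| ^+ 2 <= f u u * f v v.
Proof.
have [->|v0] := eqVneq v 0.
  by rewrite linear0r normr0 expr0n/= mulr_ge0 ?dnorm_ge0.
have fv : 0 < f v v by rewrite dnorm_gt0.
pose a := f u v / f v v.
have ow : f (u - a *: v) v = 0.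
  by rewrite linearBl linearZl_LR/= divfK ?subrr// gt_eqF.
have fuE : f u u = f (u - a *: v) (u - a *: v) + `|a| ^+ 2 * f v v.
  rewrite -dnormZ -[in LHS](subrK (a *: v) u).
  by apply: (hnormDd (form := f)); rewrite linearZr_LR/= ow mulr0.
rewrite fuE mulrDl -[leLHS]add0r lerD//.
  by rewrite mulr_ge0 ?dnorm_ge0// ltW.
rewrite /a normrM normfV exprMn exprVn (ger0_norm (ltW fv)).
by rewrite -mulrA -mulrA -expr2 mulVf ?mulr1// expf_neq0// gt_eqF.
Qed.

Lemma dot_norm_triangle u v :
  sqrtC (f (u + v) (u + v)) <= sqrtC (f u u) + sqrtC (f v v).
Proof.
have sge0 w : 0 <= sqrtC (f w w) by rewrite sqrtC_ge0 dnorm_ge0.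
rewrite -(@ler_pXn2r _ 2)// ?nnegrE ?addr_ge0//.
rewrite sqrrD !sqrtCK dnormD [leRHS]addrAC lerD2l.
have -> : f u v + (f u v)^* = 'Re (f u v) *+ 2.
  by rewrite ReE -[RHS]mulr_natr divfK ?pnatr_eq0.
rewrite lerMn2r/=; apply: (@le_trans _ _ `|f u v|).
  exact: (leif_Re_Creal (f u v)).1.
rewrite -(@ler_pXn2r _ 2)// ?nnegrE ?mulr_ge0//.
by rewrite exprMn !sqrtCK dot_CauchySchwarz.
Qed.

Lemma dot_normZ a u : sqrtC (f (a *: u) (a *: u)) = `|a| * sqrtC (f u u).
Proof.
rewrite dnormZ sqrtCM ?nnegrE ?exprn_ge0 ?dnorm_ge0//.
by rewrite sqrCK.
Qed.

Lemma dot_norm_eq0 u : sqrtC (f u u) = 0 -> u = 0.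
Proof. by move=> /eqP; rewrite sqrtC_eq0 dnorm_eq0 => /eqP. Qed.

End DotNorm.

Section BoundedOperators.
Context (K : numFieldType) (V W : normedModType K).

Definition bounded_operator : {pred V -> W} :=
  mem [set f : V -> W | linear f /\ exists M : K, forall x, `|f x| <= M * `|x|].

Lemma bounded_operatorP (f : V -> W) : f \in bounded_operator <->
  linear f /\ exists M : K, forall x, `|f x| <= M * `|x|.
Proof. by rewrite inE. Qed.

Lemma bounded_operator_submod_closed : submod_closed bounded_operator.
Proof.
split=> [|a f g /bounded_operatorP[fl [M fM]] /bounded_operatorP[gl [M' gM]]].
  apply/bounded_operatorP; split=> [a x y|].
    by change (0 = a *: 0 + 0 :> W); rewrite scaler0 addr0.
  by exists 0 => x; change (`|0 : W| <= 0 * `|x|); rewrite normr0 mul0r.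
apply/bounded_operatorP; split=> [b x y|].
  change (a *: f (b *: x + y) + g (b *: x + y) =
    b *: (a *: f x + g x) + (a *: f y + g y)).
  by rewrite fl gl !scalerDr !scalerA (mulrC a) addrACA.
exists (`|a| * M + M') => x; rewrite (le_trans (ler_normD _ _))// mulrDl.
by rewrite lerD// normrZ -mulrA ler_wpM2l.
Qed.

HB.instance Definition _ :=
  GRing.isSubmodClosed.Build _ _ bounded_operator bounded_operator_submod_closed.

Record bop := Bop { bop_val :> V -> W; _ : bop_val \in bounded_operator }.

HB.instance Definition _ := [isSub for bop_val].
HB.instance Definition _ := [Choice of bop by <:].
HB.instance Definition _ := [SubChoice_isSubLmodule of bop by <:].

Lemma bop_linear (A : bop) : linear A.
Proof. by case: A => f /= /bounded_operatorP[]. Qed.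

HB.instance Definition _ (A : bop) :=
  GRing.isLinear.Build K V W *:%R A (bop_linear A).

Lemma bop_bounded (A : bop) : exists2 M : K, 0 <= M & forall x, `|A x| <= M * `|x|.
Proof.
case: A => f /= /bounded_operatorP[_ [M fM]]; exists `|M| => // x.
have := fM x; have [->|x0] := eqVneq x 0; first by rewrite normr0 !mulr0.
have x_gt0 : 0 < `|x| by rewrite normr_gt0.
move=> fxM; have : 0 <= M * `|x| by apply: le_trans fxM.
by rewrite pmulr_lge0// => M0; rewrite ger0_norm.
Qed.

Lemma bopD (A B : bop) x : (A + B) x = A x + B x. Proof. by []. Qed.
Lemma bopZ a (A : bop) x : (a *: A) x = a *: A x. Proof. by []. Qed.
Lemma bop0 x : (0 : bop) x = 0. Proof. by []. Qed.
Lemma bop_sum I (r : seq I) P (F : I -> bop) x :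
  (\sum_(i <- r | P i) F i) x = \sum_(i <- r | P i) F i x.
Proof. by elim/big_rec2: _ => //= i y A _ <-. Qed.

Lemma bopP (A B : bop) : A =1 B -> A = B.
Proof. by move=> AB; apply: val_inj; apply: funext. Qed.

End BoundedOperators.

Notation "''L' ( E )" := (bop E E) (at level 8, format "''L' ( E )") : type_scope.

(** The Hilbert space E (x) C^n, modelled as the n-fold direct sum of E: the
    elementary tensor of e and v, [tens e v] below, is the family of the
    [v i *: e], and [tensop A M] is A (x) M.  The lemmas [dotp_tensE], [tens_sum]
    and [tensop_tens] check that these are the tensor product of Hilbert spaces
    and of operators. *)

Definition tensC (R : realType) (E : hilbertType R) (n : nat) : Type :=
  {ffun 'I_n -> E}.

Section TensorLmodule.
Context (R : realType) (E : hilbertType R) (n : nat).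

HB.instance Definition _ := GRing.Lmodule.copy (tensC E n) {ffun 'I_n -> E}.

Definition tens_dotp (x y : tensC E n) : R[i] :=
  \sum_i dotp (x i) (y i).

Lemma tens_dotp_bilinear : bilinear_for
  (GRing.Scale.Law.clone _ _ *%R _)
  (GRing.Scale.Law.clone _ _ (@Num.conj R[i] \; *%R) _)
  tens_dotp.
Proof.
split=> [y|x] a u v /=; rewrite /tens_dotp mulr_sumr -big_split/=.
  by apply: eq_bigr => i _; rewrite !ffunE linearPl.
by apply: eq_bigr => i _; rewrite !ffunE linearPr.
Qed.

HB.instance Definition _ := bilinear_isBilinear.Build R[i] (tensC E n) (tensC E n)
  R[i] _ _ tens_dotp tens_dotp_bilinear.

Lemma tens_dotp_hermitian (x y : tensC E n) :
  tens_dotp x y = (-1) ^+ false * (tens_dotp y x)^*.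
Proof.
rewrite expr0 mul1r rmorph_sum; apply: eq_bigr => i _.
by rewrite (hermC dotp) expr0 mul1r.
Qed.

HB.instance Definition _ := isHermitianSesquilinear.Build R[i] (tensC E n) false
  (@Num.conj R[i]) tens_dotp tens_dotp_hermitian.

Lemma tens_dotp_gt0 (x : tensC E n) : x != 0 -> 0 < tens_dotp x x.
Proof.
move=> x0; rewrite lt_def sumr_ge0 ?andbT => [|i _]; last exact: dnorm_ge0.
apply: contra x0 => /eqP/psumr_eq0P-/(_ (fun i _ => dnorm_ge0 _ _)) x0.
by apply/eqP/ffunP => i; rewrite ffunE; apply/eqP; rewrite -(dnorm_eq0 dotp) x0.
Qed.

HB.instance Definition _ := isDotProduct.Build R[i] (tensC E n) tens_dotp
  tens_dotp_gt0.

HB.instance Definition _ := Lmodule_isNormed.Build R[i] (tensC E n)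
  (dot_norm_triangle tens_dotp) (dot_normZ tens_dotp)
  (@dot_norm_eq0 _ _ tens_dotp).

Lemma tens_normE (x : tensC E n) : `|x| = sqrtC (\sum_i `|x i| ^+ 2).
Proof.
rewrite [LHS](_ : _ = sqrtC (tens_dotp x x))//; congr sqrtC.
by apply: eq_bigr => i _; rewrite dotp_norm.
Qed.

End TensorLmodule.

Section TensorHilbert.
Context (R : realType) (E : hilbertType R) (n : nat).

Lemma tens_norm_coord (x : tensC E n) i : `|x i| <= `|x|.
Proof.
rewrite tens_normE -(@ler_pXn2r _ 2)// ?nnegrE ?sqrtC_ge0 ?sumr_ge0//.
by rewrite sqrtCK (bigD1 i)//= lerDl sumr_ge0// => j _; rewrite exprn_ge0.
Qed.

Lemma tens_norm_le_sum (x : tensC E n) : `|x| <= \sum_i `|x i|.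
Proof.
rewrite tens_normE -(@ler_pXn2r _ 2)// ?nnegrE ?sqrtC_ge0 ?sumr_ge0//.
rewrite sqrtCK expr2 mulr_suml; apply: ler_sum => i _.
by rewrite expr2 ler_wpM2l// (bigD1 i)//= lerDl sumr_ge0.
Qed.

Lemma tens_complete (F : set_system (tensC E n)) :
  ProperFilter F -> cauchy F -> cvg F.
Proof.
move=> FF /cauchy_ballP Fc.
have cvF i : cvg ((fun x : tensC E n => x i) @ F).
  apply: cauchy_cvg; apply/cauchy_ballP => e e0.
  rewrite near_map2; apply: filterS (Fc e e0) => -[x y] /=.
  rewrite -!ball_normE /=; apply: le_lt_trans.
  by have := tens_norm_coord (x - y) i; rewrite !ffunE.
apply/cvg_ex; exists [ffun i => lim ((fun x : tensC E n => x i) @ F)].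
apply/cvgrPdist_lt => e e0.
have en0 : 0 < e / n.+1%:R by rewrite divr_gt0.
have : \forall x \near F, forall i : 'I_n,
    `|lim ((fun y : tensC E n => y i) @ F) - (x : tensC E n) i| < e / n.+1%:R.
  apply: filter_forall => i.
  by have /cvgrPdist_lt/(_ _ en0) := cvF i.
apply: filterS => x xL; apply: le_lt_trans (tens_norm_le_sum _) _.
apply: (@le_lt_trans _ _ (\sum_(i < n) e / n.+1%:R)).
  by apply: ler_sum => i _; rewrite !ffunE ltW.
rewrite sumr_const card_ord -[ltLHS]mulr_natr mulrAC ltr_pdivrMr//.
by rewrite ltr_pM2l// ltr_nat.
Qed.

HB.instance Definition _ := Uniform_isComplete.Build (tensC E n) tens_complete.

HB.instance Definition _ := CompleteNormedModule_isHilbert.Build R (tensC E n)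
  (fun x => esym (sqrtCK (tens_dotp x x))).

Lemma dotp_tens (x y : tensC E n) : dotp x y = \sum_i dotp (x i) (y i).
Proof. by []. Qed.

Definition tens (e : E) (v : 'cV[R[i]]_n) : tensC E n := [ffun i => v i 0 *: e].

Lemma dotp_tensE e f v w :
  dotp (tens e v) (tens f w) = dotp e f * \sum_i v i 0 * (w i 0)^*.
Proof.
rewrite dotp_tens mulr_sumr; apply: eq_bigr => i _.
by rewrite !ffunE linearZl_LR linearZr_LR/= mulrA mulrC.
Qed.

Lemma tens_sum (x : tensC E n) : x = \sum_i tens (x i) (delta_mx i 0).
Proof.
apply/ffunP => i; rewrite sum_ffunE (bigD1 i)//= big1 ?addr0.
  by rewrite ffunE mxE !eqxx scale1r.
by move=> j ji; rewrite ffunE mxE eq_sym (negbTE ji) scale0r.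
Qed.

Definition tensop_fun (A : 'L(E)) (M : 'M[R[i]]_n) (x : tensC E n) : tensC E n :=
  [ffun i => \sum_j M i j *: A (x j)].

Lemma tensop_subproof A M : tensop_fun A M \in @bounded_operator R[i] (tensC E n) (tensC E n).
Proof.
apply/bounded_operatorP; split=> [a x y|].
  apply/ffunP => i; rewrite !ffunE scaler_sumr -big_split/=.
  apply: eq_bigr => j _; rewrite !ffunE linearP scalerDr !scalerA.
  by rewrite (mulrC a).
have [c c0 Ac] := bop_bounded A.
exists (\sum_i \sum_j `|M i j| * c) => x.
apply: le_trans (tens_norm_le_sum _) _; rewrite mulr_suml; apply: ler_sum => i _.
rewrite ffunE mulr_suml; apply: le_trans (ler_norm_sum _ _ _) _.
apply: ler_sum => j _; rewrite normrZ -mulrA ler_wpM2l//.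
by rewrite (le_trans (Ac _))// ler_wpM2l// tens_norm_coord.
Qed.

Definition tensop (A : 'L(E)) (M : 'M[R[i]]_n) : 'L(tensC E n) :=
  Bop (tensop_subproof A M).

Lemma tensopE A M x i : tensop A M x i = \sum_j M i j *: A (x j).
Proof. by rewrite ffunE. Qed.

Lemma tensop_tens A M e v : tensop A M (tens e v) = tens (A e) (M *m v).
Proof.
apply/ffunP => i; rewrite tensopE ffunE mxE scaler_suml; apply: eq_bigr => j _.
by rewrite ffunE linearZ/= scalerA.
Qed.

End TensorHilbert.

(** The free semigroup on N generators is [seq 'I_N] ([rev] is the transpose).
    A formal power series in non-commuting indeterminates indexed by the
    alphabet [A] is its family of coefficients. *)

Definition ncseries (A L : Type) := seq A -> L.

Section Kernels.
Context (R : realType) (E : hilbertType R) (N : nat).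
Implicit Types (K : ncseries ('I_N + 'I_N) 'L(E)) (w : seq 'I_N).

(** In the alphabet ['I_N + 'I_N], [inl j] is z_j and [inr j] is z'_j. *)
Definition kernel_word w w' : seq ('I_N + 'I_N) := map inl w ++ map inr (rev w').

(** The coefficient K_{w,w'} of z^w z'^(w'^T). *)
Definition kcoef K w w' : 'L(E) := K (kernel_word w w').

(** K is of the form \sum_(w, w') K_{w,w'} z^w z'^(w'^T). *)
Definition kernel_series K : Prop :=
  forall u, (forall w w', u <> kernel_word w w') -> K u = 0.

Definition positive_nc_kernel K : Prop :=
  forall (l : nat) (w : 'I_l -> seq 'I_N) (h : 'I_l -> E),
    0 <= \sum_j \sum_k dotp (kcoef K (w j) (w k) (h k)) (h j).

Definition positive_kernel (T : Type) (D : set T) (H : hilbertType R)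
    (k : T -> T -> 'L(H)) : Prop :=
  forall (l : nat) (z : 'I_l -> T) (x : 'I_l -> H),
    (forall j, D (z j)) ->
    0 <= \sum_i \sum_j dotp (k (z i) (z j) (x j)) (x i).

Definition mxword n (Z : 'I_N -> 'M[R[i]]_n) w : 'M[R[i]]_n :=
  \big[mulmx/1%:M]_(j <- w) Z j.

Definition mxtuple_adj n (Z : 'I_N -> 'M[R[i]]_n) : 'I_N -> 'M[R[i]]_n :=
  fun j => (Z j)^t*.

Definition Nilp_rank n (r : nat) : set ('I_N -> 'M[R[i]]_n) :=
  [set Z | forall w, (r <= size w)%N -> mxword Z w = 0].

Definition Nilp n : set ('I_N -> 'M[R[i]]_n) :=
  \bigcup_(r in [set r | (0 < r)%N]) @Nilp_rank n r.

Definition kterm n K (Z Z' : 'I_N -> 'M[R[i]]_n) (p : seq 'I_N * seq 'I_N) :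
    'L(tensC E n) :=
  tensop (kcoef K p.1 p.2) (mxword Z p.1 *m mxword (mxtuple_adj Z') (rev p.2)).

(** [\sum_(p \in _)] is the sum over the finite support of the summand (and 0
    should that support be infinite); see [finite_kterm]. *)
Definition keval n K (Z Z' : 'I_N -> 'M[R[i]]_n) : 'L(tensC E n) :=
  \sum_(p \in [set: seq 'I_N * seq 'I_N]) kterm K Z Z' p.

Lemma kernel_word_inj w1 w1' w2 w2' :
  kernel_word w1 w1' = kernel_word w2 w2' -> w1 = w2 /\ w1' = w2'.
Proof.
pose l (a : 'I_N + 'I_N) := if a is inl j then Some j else None.
pose r (a : 'I_N + 'I_N) := if a is inr j then Some j else None.
have lE w w' : pmap l (kernel_word w w') = w.
  rewrite /kernel_word pmap_cat; have -> : pmap l (map inl w) = w.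
    by elim: w => //= j w ->.
  by elim: (rev w') => //=; rewrite cats0.
have rE w w' : rev (pmap r (kernel_word w w')) = w'.
  rewrite /kernel_word pmap_cat; have -> : pmap r (map inl w) = [::] by elim: w.
  rewrite -[RHS]revK; congr rev.
  by elim: (rev w') => //= j s ->.
by move=> e; split; [rewrite -(lE w1 w1') e lE|rewrite -(rE w1 w1') e rE].
Qed.

Lemma mxword_cat n (Z : 'I_N -> 'M[R[i]]_n) w w' :
  mxword Z (w ++ w') = mxword Z w *m mxword Z w'.
Proof.
elim: w => [|j w IH]; first by rewrite /mxword big_nil mul1mx.
by move: IH; rewrite /mxword /= !big_cons => ->; rewrite mulmxA.
Qed.

Lemma mxword_adj n (Z : 'I_N -> 'M[R[i]]_n) w :
  mxword (mxtuple_adj Z) (rev w) = (mxword Z w)^t*.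
Proof.
elim: w => [|j w IH]; first by rewrite /mxword !big_nil trmx1 map_mx1.
rewrite rev_cons -cats1 mxword_cat IH /mxword big_cons big_nil big_cons mulmx1.
by rewrite trmx_mul map_mxM.
Qed.

Lemma finite_words (r : nat) : finite_set [set w : seq 'I_N | (size w < r)%N].
Proof.
elim: r => [|r IH].
  by apply: (sub_finite_set _ (finite_set0 _)) => w /=; rewrite ltn0.
apply: (@sub_finite_set _ _ ([set [::]] `|`
    [set j :: w | j in [set: 'I_N] & w in [set w : seq 'I_N | (size w < r)%N]])).
  by move=> [|j w] /= wr; [left|right; exists j => //; exists w].
rewrite finite_setU; split=> //.
by apply: finite_image2 => //; exact: finite_finset.
Qed.

Lemma finite_kterm n K (Z Z' : 'I_N -> 'M[R[i]]_n) : Nilp Z -> Nilp Z' ->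
  finite_set ([set: seq 'I_N * seq 'I_N] `&` kterm K Z Z' @^-1` [set~ 0]).
Proof.
move=> [r _ Zr] [r' _ Zr']; apply: (@sub_finite_set _ _
  ([set w : seq 'I_N | (size w < r)%N] `*` [set w : seq 'I_N | (size w < r')%N])).
  move=> [w w'] [_] /= k0; rewrite !ltnNge; split; apply/negP.
    move=> /Zr w0; apply: k0; apply: bopP => x; apply/ffunP => i.
    rewrite tensopE /= w0 mul0mx !ffunE big1// => j _; by rewrite mxE scale0r.
  move=> /Zr' w0; apply: k0; apply: bopP => x; apply/ffunP => i.
  rewrite tensopE /= mxword_adj w0 trmx0 map_mx0 mulmx0 !ffunE big1// => j _.
  by rewrite mxE scale0r.
by apply: finite_setX; exact: finite_words.
Qed.

End Kernels.

(* Main.v *)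
Require Import Defs.
From mathcomp Require Import all_boot all_order all_algebra complex.
From mathcomp Require Import all_classical all_reals all_analysis.
From mathcomp Require Import sesquilinear.

Set Implicit Arguments.
Unset Strict Implicit.
Unset Printing Implicit Defensive.

Import Order.TTheory GRing.Theory Num.Theory.

(** For nilpotent tuples Z_j and vectors x_j, let
    Y_w = sum_j (I (x) Z_j^w)^* x_j and let Y_w(a) be its a-th coordinate in E.
    Moving the matrix factors to the other side of the inner product gives
    [gram_keval]:

      sum_(i,j) <K(Z_i, Z_j) x_j, x_i>
        = sum_a sum_(u,v) <K_(u,v) Y_v(a), Y_u(a)>,

    where u, v range over the words up to a length beyond which all Z_j^w vanish.
    For each a the inner double sum is one of those that occur in the definition
    of a positive non-commutative kernel; this gives the direct implication.

    Conversely, given vectors h_w of E, points and vectors must be found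
    with Y_w = h_w (x) e for one fixed unit vector e and all w of length at most
    r.  On the truncated Fock space, which has a basis e_v indexed by the words v
    of length at most r, take the creation operators Z_i e_v = e_(g_i v) and
    x = sum_v h_v (x) e_v.  Then (I (x) Z^u)^* x = sum_v h_(uv) (x) e_v, where v
    ranges over the words such that |uv| <= r.  The terms with v nonempty are
    unwanted, and a second point removes them: let Z'_i agree with Z_i, except
    that it kills the vacuum vector e_[], and let x' be x without its vacuum
    component.  Then (I (x) Z'^u)^* x' is the same sum over nonempty v only.
    Hence for the points Z, Z' and the vectors x, -x' one gets exactly
    Y_u = h_u (x) e_[]. *)

Local Open Scope classical_set_scope.
Local Open Scope ring_scope.
Local Open Scope sesquilinear_scope.

Section Gram.
Context (R : realType) (E : hilbertType R) (N : nat).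
Implicit Types (K : ncseries ('I_N + 'I_N) 'L(E)).

Lemma positive_nc_kernel_fin K (T : finType) (w : T -> seq 'I_N) (h : T -> E) :
  positive_nc_kernel K ->
  0 <= \sum_s \sum_t dotp (kcoef K (w s) (w t) (h t)) (h s).
Proof.
move=> Kpos; have := Kpos #|T| (w \o enum_val) (h \o enum_val).
congr (0 <= _); rewrite [RHS](reindex (@enum_val T T))/=;
  last exact/onW_bij/enum_val_bij.
by apply: eq_bigr => j _;
  rewrite [RHS](reindex (@enum_val T T))//; exact/onW_bij/enum_val_bij.
Qed.

(** This is (I (x) Z^w)^* x. *)
Definition word_adj n (Z : 'I_N -> 'M[R[i]]_n) (w : seq 'I_N) (x : tensC E n) :
    tensC E n :=
  [ffun a => \sum_p Num.conj (mxword Z w p a) *: x p].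

(** The factor (I (x) Z^u) of K_(u,v) (x) Z^u (Z'^v)^* goes to the right of the
    inner product, and the factor (I (x) Z'^v)^* is absorbed into the vector on
    the left; what remains is K_(u,v) (x) I, which acts coordinatewise. *)
Lemma dotp_kterm n K (Z Z' : 'I_N -> 'M[R[i]]_n) p (x x' : tensC E n) :
  dotp (kterm K Z Z' p x') x =
  \sum_a dotp (kcoef K p.1 p.2 (word_adj Z' p.2 x' a)) (word_adj Z p.1 x a).
Proof.
rewrite dotp_tens.
under eq_bigr => i _ do rewrite tensopE linear_sumlz.
under [RHS]eq_bigr => a _.
  rewrite !ffunE linear_sumr.
  under eq_bigr => i _ do rewrite linear_sum linear_sumlz.
  over.
rewrite [RHS]exchange_big; apply: eq_bigr => i _.
rewrite [RHS]exchange_big; apply: eq_bigr => j _.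
rewrite linearZl_LR/= mxE mulr_suml mxword_adj; apply: eq_bigr => a _.
rewrite linearZr_LR/= conjCK !mxE -mulrA; congr (_ * _).
by rewrite linearZ linearZl_LR.
Qed.

(** Words of length greater than r contribute nothing to the series, and those
    of length at most r form a finite type. *)
Lemma keval_bseq n r K (Z Z' : 'I_N -> 'M[R[i]]_n) :
  Nilp_rank r.+1 Z -> Nilp_rank r.+1 Z' ->
  keval K Z Z' = \sum_(u : r.-bseq 'I_N) \sum_(v : r.-bseq 'I_N)
    kterm K Z Z' (bseqval u, bseqval v).
Proof.
move=> Zr Z'r.
pose f (p : r.-bseq 'I_N * r.-bseq 'I_N) := (bseqval p.1, bseqval p.2).
have f_inj : injective f.
  by move=> [u v] [u' v'] [uu' vv']; congr pair; apply: val_inj.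
rewrite pair_big/= /keval.
rewrite (fsbigE [seq f p | p <- enum {: r.-bseq 'I_N * r.-bseq 'I_N}]).
- by rewrite big_map big_enum_cond; apply: eq_bigl => p; rewrite in_setT.
- by rewrite map_inj_uniq ?enum_uniq.
- by [].
move=> [w w'] _ /negP ww'; apply: bopP => x; apply/ffunP => i.
rewrite tensopE/= mxword_adj.
suff -> : mxword Z w *m (mxword Z' w')^t* = 0.
  by rewrite big1 ?ffunE// => j _; rewrite mxE scale0r.
have [wr|/Zr->] := leqP (size w) r; last by rewrite mul0mx.
have [w'r|/Z'r->] := leqP (size w') r; last by rewrite trmx0 map_mx0 mulmx0.
case: ww'; apply/mapP; exists (Bseq wr, Bseq w'r) => //.
by rewrite mem_enum.
Qed.

Lemma dotp_keval n r K (Z Z' : 'I_N -> 'M[R[i]]_n) (x x' : tensC E n) :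
  Nilp_rank r.+1 Z -> Nilp_rank r.+1 Z' ->
  dotp (keval K Z Z' x') x =
  \sum_a \sum_(u : r.-bseq 'I_N) \sum_(v : r.-bseq 'I_N)
    dotp (kcoef K u v (word_adj Z' v x' a)) (word_adj Z u x a).
Proof.
move=> Zr Z'r; rewrite (keval_bseq K Zr Z'r) bop_sum linear_sumlz [RHS]exchange_big.
apply: eq_bigr => u _; rewrite bop_sum linear_sumlz [RHS]exchange_big.
by apply: eq_bigr => v _; exact: dotp_kterm.
Qed.

(** Since the expression of [dotp_keval] is sesquilinear in the vectors
    [word_adj], summing over all pairs of points replaces these vectors by their
    sums over the points. *)
Lemma gram_keval n r l K (Z : 'I_l -> 'I_N -> 'M[R[i]]_n) (x : 'I_l -> tensC E n) :
  (forall j, Nilp_rank r.+1 (Z j)) ->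
  \sum_i \sum_j dotp (keval K (Z i) (Z j) (x j)) (x i) =
  \sum_a \sum_(u : r.-bseq 'I_N) \sum_(v : r.-bseq 'I_N)
    dotp (kcoef K u v ((\sum_j word_adj (Z j) v (x j)) a))
         ((\sum_j word_adj (Z j) u (x j)) a).
Proof.
move=> Zr.
transitivity (\sum_i \sum_j \sum_a \sum_(u : r.-bseq 'I_N) \sum_(v : r.-bseq 'I_N)
    dotp (kcoef K u v (word_adj (Z j) v (x j) a)) (word_adj (Z i) u (x i) a)).
  by apply: eq_bigr => i _; apply: eq_bigr => j _; exact: dotp_keval.
under eq_bigr => i _ do rewrite exchange_big/=.
rewrite exchange_big/=; apply: eq_bigr => a _.
under eq_bigr => i _ do rewrite exchange_big/=.
rewrite exchange_big/=; apply: eq_bigr => u _.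
under eq_bigr => i _ do rewrite exchange_big/=.
rewrite exchange_big/=; apply: eq_bigr => v _.
rewrite !sum_ffunE linear_sumr; apply: eq_bigr => i _.
by rewrite linear_sum linear_sumlz.
Qed.

End Gram.

Section Fock.
Context (R : realType) (E : hilbertType R) (N r : nat).
Implicit Types (K : ncseries ('I_N + 'I_N) 'L(E)) (u v w : seq 'I_N).

Local Notation dim := #|{: r.-bseq 'I_N}|.

Definition word_at (p : 'I_dim) : seq 'I_N := bseqval (enum_val p).

Lemma word_at_inj : injective word_at.
Proof. by move=> p q /val_inj/enum_val_inj. Qed.

Lemma size_word_at p : (size (word_at p) <= r)%N.
Proof. exact: size_bseq. Qed.

Lemma word_at_surj w : (size w <= r)%N -> exists p, word_at p = w.
Proof. by move=> wr; exists (enum_rank (Bseq wr)); rewrite /word_at enum_rankK. Qed.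

(** The creation operators e_v |-> e_(g_i v), truncated at length r; when [b] is
    false they also kill the vacuum vector e_[]. *)
Definition fock_shift (b : bool) (i : 'I_N) : 'M[R[i]]_dim :=
  \matrix_(p, q) ((word_at p == i :: word_at q) && (b || (word_at q != [::])))%:R.

(** Z^u e_v = e_(uv).  When the vacuum is killed, a nonempty u sends e_[] to 0
    at its first step, while on e_v with v nonempty nothing changes, because the
    vacuum is never reached. *)
Lemma mxword_fock_shift b u p q : mxword (fock_shift b) u p q =
  ((word_at p == u ++ word_at q) && [|| b, nilp u | word_at q != [::]])%:R.
Proof.
elim: u p q => [|i u IHu] p q.
  by rewrite /mxword big_nil mxE (inj_eq word_at_inj) orbT andbT.
rewrite /mxword big_cons mxE -/(mxword _ _).
under eq_bigr => s _ do rewrite IHu mxE -natrM mulnb.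
have [pE|pN] := eqVneq (word_at p) (i :: u ++ word_at q); last first.
  rewrite big1//= => s _.
  case: (word_at s =P u ++ word_at q) => [->|_]; last by rewrite andbF.
  by rewrite (negbTE pN).
(* The suffix of a word of length at most r is again a basis word, so exactly one
   intermediate index contributes. *)
have [s sE] : exists s, word_at s = u ++ word_at q.
  by apply: word_at_surj; have := size_word_at p; rewrite pE => /ltnW.
rewrite (bigD1 s)//= big1 ?addr0 => [|t ts].
  rewrite sE pE !eqxx/=; congr (_%:R); move: {IHu pE sE}(word_at q) => v.
  by case: b u v => [] [|? ?] [|? ?].
by rewrite -sE (inj_eq word_at_inj) (negbTE ts) andbF.
Qed.

Lemma Nilp_fock_shift b : Nilp_rank r.+1 (fock_shift b).
Proof.
move=> u ur; apply/matrixP => p q; rewrite mxword_fock_shift mxE.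
case: eqP => //= pE; have := size_word_at p.
by rewrite pE size_cat leqNgt (leq_trans ur)// leq_addr.
Qed.

(** The vector sum_v h_v (x) e_v, without its vacuum component when [b] is
    false. *)
Definition fock_vec (b : bool) (h : seq 'I_N -> E) : tensC E dim :=
  [ffun p => if b || (word_at p != [::]) then h (word_at p) else 0].

(** Killing the vacuum in both the operators and the vector changes nothing
    outside the vacuum coordinate, where the result becomes 0, also for u = []. *)
Lemma word_adj_fock b h u a :
  word_adj (fock_shift b) u (fock_vec b h) a =
  if (size (u ++ word_at a) <= r)%N && (b || (word_at a != [::]))
  then h (u ++ word_at a) else 0.
Proof.
rewrite ffunE.
under eq_bigr => p _ do rewrite mxword_fock_shift conjC_nat ffunE.
have [ur|ur]/= := leqP (size (u ++ word_at a)) r; last first.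
  rewrite big1// => p _; case: eqP => [pE|]; last by rewrite scale0r.
  by have := size_word_at p; rewrite pE leqNgt ur.
have [p pE] := word_at_surj ur.
rewrite (bigD1 p)//= big1 ?addr0 => [|t tp].
  rewrite pE eqxx/=; move: {ur pE}(word_at a) => v.
  by case: b u v => [] [|? ?] [|? ?] /=; rewrite ?(scale1r, scale0r, scaler0).
by rewrite -pE (inj_eq word_at_inj) (negbTE tp) scale0r.
Qed.

(** Two points are enough: the full and the vacuum-killing creation operators,
    with opposite signs on the vectors, leave only the vacuum coordinate. *)
Lemma positive_kernel_words K (h : seq 'I_N -> E) :
  (forall n, positive_kernel (@Nilp R N n) (fun Z Z' => keval K Z Z')) ->
  0 <= \sum_(u : r.-bseq 'I_N) \sum_(v : r.-bseq 'I_N)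
    dotp (kcoef K u v (h v)) (h u).
Proof.
pose Z (j : 'I_2) := fock_shift (j == 0).
pose x (j : 'I_2) := (-1) ^+ j *: fock_vec (j == 0) h.
have Zr j : Nilp_rank r.+1 (Z j) by exact: Nilp_fock_shift.
move=> /(_ dim 2%N Z x (fun j => ex_intro2 _ _ r.+1 isT (Zr j))).
rewrite (gram_keval K x Zr).
have YE (u : r.-bseq 'I_N) a :
    (\sum_j word_adj (Z j) u (x j)) a = if word_at a == [::] then h u else 0.
  have adjE j : word_adj (Z j) u (x j) a =
      (-1) ^+ j *: word_adj (fock_shift (j == 0)) u (fock_vec (j == 0) h) a.
    rewrite !ffunE scaler_sumr; apply: eq_bigr => p _.
    by rewrite /x ffunE !scalerA mulrC.
  rewrite sum_ffunE !big_ord_recl big_ord0 addr0 !adjE !word_adj_fock/=.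
  rewrite expr0 expr1 scale1r scaleN1r andbT.
  case: eqP => [->|_]; first by rewrite cats0 size_bseq andbF oppr0 addr0.
  by rewrite andbT subrr.
have [a0 a0E] : exists p, word_at p = [::] by exact: word_at_surj.
rewrite (bigD1 a0)//= [X in _ + X]big1 ?addr0 => [|a aa0].
  congr (0 <= _); apply: eq_bigr => u _; apply: eq_bigr => v _.
  by rewrite !YE a0E.
rewrite big1// => u _; rewrite big1// => v _.
by rewrite !YE -a0E (inj_eq word_at_inj) (negbTE aa0) linear0r.
Qed.

End Fock.

Theorem theorem1 (R : realType) (E : hilbertType R) (N : nat)
    (K : ncseries ('I_N + 'I_N) 'L(E)) (hK : kernel_series K) :
  positive_nc_kernel K <->
  forall n : nat,
    positive_kernel (@Nilp R N n) (fun Z Z' => keval K Z Z').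
Proof.
split=> [Kpos n l Z x Znilp|Kpos l w h].
  have /choice[r rP] j : exists r, Nilp_rank r (Z j).
    by have [r _] := Znilp j; exists r.
  pose m := \max_j r j.
  have Zr j : Nilp_rank m.+1 (Z j).
    by move=> v mv; apply: rP; rewrite (leq_trans _ (ltnW mv))// leq_bigmax.
  rewrite (gram_keval K x Zr); apply: sumr_ge0 => a _.
  exact: (@positive_nc_kernel_fin _ _ _ K {: m.-bseq 'I_N} (fun u => bseqval u)
    (fun u => (\sum_j word_adj (Z j) u (x j)) a)).
pose r := \max_j size (w j).
have wr j : (size (w j) <= r)%N by exact: leq_bigmax.
pose f j : r.-bseq 'I_N := Bseq (wr j).
(* The given words may repeat, so the vectors attached to equal words are added
   up; sorting the indices by their words recovers the original sum. *)
have := positive_kernel_words r (fun u => \sum_(j | w j == u) h j) Kpos.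
congr (0 <= _); rewrite [RHS](partition_big f xpredT)//=; apply: eq_bigr => u _.
under eq_bigr => v _ do rewrite linear_sumr.
rewrite exchange_big/=; apply: eq_big => // j /eqP wj.
rewrite [RHS](partition_big f xpredT)//=; apply: eq_bigr => v _.
rewrite linear_sum linear_sumlz; apply: eq_big => // k /eqP wk.
by rewrite -wj -wk.
Qed.
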